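(* Let $q>p\ge 3$ be coprime integers. Let $\langle p,q\rangle=\{iq+jp : i,j\in\mathbb{Z},\ i,j\ge 0\}$, $\varphi(p,q)=(p-1)(q-1)$ and $\vartheta=\varphi(p,q)/2$. List the elements of $S(p,q)=\langle p,q\rangle\cap[0,\varphi(p,q)]$ increasingly as $\ell_0<\ell_1<\dots<\ell_\vartheta$, and list the positive integers not in $\langle p,q\rangle$ increasingly as $n_1<n_2<\dots<n_\vartheta$. Put $S_\Delta(p,q)=\{\ell_{j+1}-\ell_j : 0\le j\le \vartheta-1\}$ and $N_\Delta(p,q)=\{n_{j+1}-n_j : 1\le j\le\vartheta-1\}$. Define $r_0=p$, $r_1=\langle q\rangle_p$ (the least nonnegative residue of $q$ modulo $p$), and run the Euclidean algorithm: for $1\le i\le t$, $r_{i-1}=Z_ir_i+r_{i+1}$ with integers $Z_i$ and $0\le r_{i+1}<r_i$, where $t$ is the index with $r_t=1$ (so $r_{t+1}=0$). Then: (i) If $q\ne p+1$, then $S_\Delta(p,q)=N_\Delta(p,q)$. If $q=p+1$, then $S_\Delta(p,q)=N_\Delta(p,q)\cup\{2\}$ and $2\notin N_\Delta(p,q)$. (ii) $S_\Delta(p,q)=\{\,r_{i-1}-zr_i : 1\le i\le t,\ 0\le z\le Z_i-1\,\}$.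
   Context: It is known that the positive integers not in $\langle p,q\rangle$ are exactly $\vartheta$ in number, the largest being $pq-p-q$, and that $S(p,q)$ has exactly $\vartheta+1$ elements, with $\ell_0=0$ and $\ell_\vartheta=(p-1)(q-1)$. For an integer $x$, $\langle x\rangle_p$ denotes the unique integer with $\langle x\rangle_p\equiv x \pmod p$ and $0\le\langle x\rangle_p<p$. *)

(* Defs.v *)
From mathcomp Require Export all_boot.
From mathcomp Require Export classical_sets.

Set Implicit Arguments.
Unset Strict Implicit.
Unset Printing Implicit Defensive.

Local Open Scope classical_set_scope.

Definition num_semigroup (p q : nat) : set nat :=
  [set x | exists i j : nat, x = i * q + j * p].

Definition phi (p q : nat) : nat := (p - 1) * (q - 1).

(* The quotient is exact for coprime [p] and [q]. *)
Definition theta (p q : nat) : nat := phi p q %/ 2.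

Definition small_elements (p q : nat) : set nat :=
  num_semigroup p q `&` [set x | x <= phi p q].

Definition gaps (p q : nat) : set nat :=
  [set x | 0 < x /\ ~ num_semigroup p q x].

(* Only the values of [u] at the indices [a, ..., b] matter. *)
Definition lists_increasingly (u : nat -> nat) (a b : nat) (A : set nat) : Prop :=
  (forall j, a <= j < b -> u j < u j.+1) /\
  A = [set u j | j in [set j | a <= j <= b]].

(* The truncated subtraction is the integer one for [u] increasing on
   [a, ..., b]. *)
Definition consecutive_differences (u : nat -> nat) (a b : nat) : set nat :=
  [set u j.+1 - u j | j in [set j | a <= j < b]].

(* The conditions force [0 < t] when [1 < p], [r t.+1 = 0], and determine [t],
   [r] on [0, ..., t.+1] and [Z] on [1, ..., t]. *)
Definition euclidean_algorithm (p q t : nat) (r Z : nat -> nat) : Prop :=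
  [/\ r 0 = p,
      r 1 = q %% p,
      forall i, 1 <= i <= t -> r (i - 1) = Z i * r i + r i.+1 /\ r i.+1 < r i
    & r t = 1].

(* Along the Euclidean algorithm [z * r i <= r (i - 1)] for [z < Z i], so no
   subtraction truncates. *)
Definition euclidean_differences (t : nat) (r Z : nat -> nat) : set nat :=
  [set d | exists i z : nat,
     [/\ 1 <= i <= t, z < Z i & d = r (i - 1) - z * r i]].

(* Main.v *)
(** Write F = pq - p - q. The reflection x -> F - x exchanges the semigroup and
    its complement in [0, F], so the differences between consecutive gaps are
    those between consecutive elements of the semigroup in [0, F - 1]; the only
    other difference comes from the last two elements F - 1 and F + 1, and it
    is 2.

    For the description of the differences, write a small element as iq + jp
    with 0 <= i < p. If the next one has coefficient i' of q, their difference s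
    is congruent to (i' - i)q modulo p, and no smaller positive residue is
    attained by a multiple cq with c between 0 and i' - i: s is a one-sided
    record minimum of the residues of the multiples of q. The subtractive
    Euclidean algorithm run on (q mod p, p) maintains a basis (d, a), (u, -k) of
    the lattice {(x, c) : x = cq mod p}, and its successive values d and u are
    precisely these records. *)

Require Import Defs.
From mathcomp Require Import all_boot classical_sets.
From mathcomp Require Import zify.

Set Implicit Arguments.
Unset Strict Implicit.
Unset Printing Implicit Defensive.

Local Open Scope classical_set_scope.

(** * Consecutive differences without indices *)

(** By strict monotonicity, listed elements with none between them have adjacent indices. Later
    arguments can thus speak of the sets alone. *)
Lemma consecutive_differencesP (u : nat -> nat) (a b : nat) (A : set nat)
    (d : nat) :
  lists_increasingly u a b A ->
  consecutive_differences u a b d <->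
  exists x, [/\ A x, A (x + d), 0 < d & forall z, x < z < x + d -> ~ A z].
Proof.
move=> [uinc ->].
have umono i j : a <= i -> i < j -> j <= b -> u i < u j.
  move=> ai; elim: j => // j IHj ij jb.
  have uj : u j < u j.+1 by apply: uinc; lia.
  have [ltij|leji] := ltnP i j; first by have := IHj ltij (ltnW jb); lia.
  by have -> : i = j by lia.
split=> [[j /= jab <-]|[_ [[i /= iab <-] [j /= jab uj] d0 no]]].
  have uj := uinc j jab; exists (u j); rewrite subnKC ?(ltnW uj)//; split.
  - by exists j => //=; lia.
  - by exists j.+1 => //=; lia.
  - by rewrite subn_gt0.
  move=> z zj [i /= iab uiz]; subst z.
  have [lti|lti|eqi] := ltngtP i j; last by subst i; lia.
    by have := umono i j; lia.
  have [|eqij] := ltnP j.+1 i; first by have := umono j.+1 i; lia.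
  have eqi : i = j.+1 by lia.
  by subst i; lia.
have ltij : i < j.
  rewrite ltnNge; apply/negP; rewrite leq_eqVlt => /orP[/eqP eqij|ltji].
    by subst i; lia.
  by have := umono j i; lia.
exists i => /=; first lia.
have [ltSi|leSi] := ltnP i.+1 j.
  case: (no (u i.+1)); last by exists i.+1 => //=; lia.
  by have := umono i i.+1; have := umono i.+1 j; lia.
have eqj : j = i.+1 by lia.
by subst j; lia.
Qed.

(** * The semigroup and its reflection in the Frobenius number *)

Section Semigroup.
Variables p q : nat.
Hypotheses (p_ge3 : 3 <= p) (ltpq : p < q) (co_pq : coprime p q).

Let F := p * q - p - q.

Let F_def : F + p + q = p * q. Proof. rewrite /F; nia. Qed.

Let phiE : phi p q = F.+1. Proof. rewrite /phi /F; nia. Qed.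

Lemma num_semigroup_coef_ltn (x : nat) : num_semigroup p q x ->
  exists i j, i < p /\ x = i * q + j * p.
Proof.
move=> [i [j ->]]; exists (i %% p), (j + i %/ p * q); split.
  by rewrite ltn_mod; lia.
rewrite {1}(divn_eq i p); nia.
Qed.

Lemma solve_mod (x : nat) : exists2 i, i < p & i * q = x %[mod p].
Proof.
have [u v uv _] := @egcdnP q p ltac:(lia).
exists (u * x %% p); first by rewrite ltn_mod; lia.
rewrite modnMml mulnAC uv.
move: co_pq; rewrite /coprime gcdnC => /eqP ->.
by rewrite mulnDl mul1n mulnAC modnMDl.
Qed.

(** If both were in, [p * q] would be a combination of [q] and [p] with positive coefficients; by
    coprimality [p] divides that of [q], whose term alone reaches [p * q]. Conversely, take [i < p]
    with [i * q] congruent to [x]: if [i * q = x + b * p] with [b > 0], then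
    [F - x = (p - 1 - i) * q + (b - 1) * p]. *)
Lemma num_semigroup_sym (x : nat) : x <= F ->
  num_semigroup p q x <-> ~ num_semigroup p q (F - x).
Proof.
move=> xF; split=> [[i [j xE]] [i' [j' yE]]|notS].
  have eqF : (i + i').+1 * q + (j + j').+1 * p = p * q by nia.
  have pi : p <= (i + i').+1.
    apply: dvdn_leq => //; rewrite -(Gauss_dvdl _ co_pq).
    by rewrite -(dvdn_addl _ (dvdn_mull (j + j').+1 (dvdnn p))) eqF dvdn_mulr.
  by nia.
have [i ip /eqP eqi] := solve_mod x.
have [le|lt] := leqP (i * q) x.
  move: eqi; rewrite eq_sym eqn_mod_dvd// => /dvdnP[j jE].
  by exists i, j; lia.
move: eqi; rewrite eqn_mod_dvd ?(ltnW lt)// => /dvdnP[b bE].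
have [i' pE] : exists i', p = i + i'.+1 by exists (p - i.+1); lia.
have [b' b'E] : exists b', b = b'.+1 by exists b.-1; nia.
have pqE : p * q = i * q + i' * q + q by rewrite {1}pE; lia.
by case: notS; exists i', b'; rewrite b'E in bE; lia.
Qed.

(** If [i * q] with [i < p] exceeded [x] in its residue class, [x] would be at most
    [(p - 1) * q - p = F]. *)
Lemma num_semigroup_gtn_Frobenius (x : nat) : F < x -> num_semigroup p q x.
Proof.
move=> Fx; have [i ip /eqP eqi] := solve_mod x.
have [le|lt] := leqP (i * q) x.
  move: eqi; rewrite eq_sym eqn_mod_dvd// => /dvdnP[j jE].
  by exists i, j; lia.
move: eqi; rewrite eqn_mod_dvd ?(ltnW lt)// => /dvdnP[b bE].
have b0 : p <= b * p by rewrite leq_pmull//; nia.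
have iq : i.+1 * q <= p * q by rewrite leq_pmul2r//; lia.
by exfalso; lia.
Qed.

Lemma num_semigroup0 : num_semigroup p q 0.
Proof. by exists 0, 0. Qed.

Lemma num_semigroup_F : ~ num_semigroup p q F.
Proof.
have := num_semigroup_sym (leqnn F); rewrite subnn => h /h; apply.
exact: num_semigroup0.
Qed.

Lemma num_semigroup1 : ~ num_semigroup p q 1.
Proof. by move=> [[|i] [[|j] e]]; lia. Qed.

Lemma gapsP (x : nat) :
  gaps p q x <-> [/\ 0 < x, x <= F & num_semigroup p q (F - x)].
Proof.
split=> [[x0 notS]|[x0 xF Sx]]; last first.
  split=> // S'; apply: (num_semigroup_sym xF).1 => //.
have xF : x <= F.
  by rewrite leqNgt; apply/negP => /num_semigroup_gtn_Frobenius.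
split=> //; apply/num_semigroup_sym; first lia.
by rewrite subKn.
Qed.

Lemma small_between (x d : nat) : small_elements p q (x + d) ->
    (forall z, x < z < x + d -> ~ small_elements p q z) ->
  forall z, x < z < x + d -> ~ num_semigroup p q z.
Proof. by move=> [_ /= le] no z zI Sz; apply: (no z zI); split=> //=; lia. Qed.

(** * Differences of small elements and of gaps *)

Definition small_diff (d : nat) := exists x,
  [/\ small_elements p q x, small_elements p q (x + d), 0 < d
    & forall z, x < z < x + d -> ~ small_elements p q z].

Definition gap_diff (d : nat) := exists x,
  [/\ gaps p q x, gaps p q (x + d), 0 < d
    & forall z, x < z < x + d -> ~ gaps p q z].

Lemma small_diff2 : small_diff 2.
Proof.
have F0 : 1 <= F by nia.
have S' : num_semigroup p q (F - 1).
  by apply/num_semigroup_sym; [lia|rewrite subKn//; exact: num_semigroup1].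
exists (F - 1); split=> //.
- by split=> //=; rewrite phiE; lia.
- have -> : F - 1 + 2 = F.+1 by lia.
  by split; [exact: num_semigroup_gtn_Frobenius|rewrite /= phiE].
move=> z zI [Sz _]; apply: num_semigroup_F.
by have <- : z = F by lia.
Qed.

Lemma gap_diff_small (d : nat) : gap_diff d -> small_diff d.
Proof.
move=> [x [/gapsP[x0 xF Sx] /gapsP[y0 yF Sy] d0 no]].
exists (F - (x + d)); have E : F - (x + d) + d = F - x by lia.
split=> //.
- by split=> //=; rewrite phiE; lia.
- by rewrite E; split=> //=; rewrite phiE; lia.
rewrite E => z zI [Sz _]; apply: (no (F - z)); first lia.
by apply/gapsP; split; [lia|lia|rewrite subKn//; lia].
Qed.

Lemma small_diff_gap (d : nat) : small_diff d -> gap_diff d \/ d = 2.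
Proof.
move=> [x [[Sx xle] [Sy /= yle] d0 no]].
rewrite /= phiE in xle yle.
have yF : x + d <> F by move=> e; apply: num_semigroup_F; rewrite -e.
have xF : x <> F by move=> e; apply: num_semigroup_F; rewrite -e.
have [le|gt] := leqP (x + d) F; [left|right].
  exists (F - (x + d)); have E : F - (x + d) + d = F - x by lia.
  split=> //.
  - by apply/gapsP; split; [lia|lia|rewrite subKn].
  - by rewrite E; apply/gapsP; split; [lia|lia|rewrite subKn//; lia].
  move=> z zI /gapsP[z0 zF Sz]; apply: (no (F - z)); first lia.
  by split=> //=; rewrite phiE; lia.
(* The pair now straddles [F], so its upper element is [F + 1]; the lower one is [F - 1], the
   reflection of the gap 1. *)
have F1 : 1 <= F by nia.
have S' : num_semigroup p q (F - 1).
  by apply/num_semigroup_sym; [lia|rewrite subKn//; exact: num_semigroup1].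
have [|] := ltnP x (F - 1); last by lia.
move=> lt; case: (no (F - 1)); first lia.
by split=> //=; rewrite phiE; lia.
Qed.

(** Here [q > p + 1], and the gaps [p - 1] and [p + 1] surround [p]. *)
Lemma gap_diff2 : q <> p + 1 -> gap_diff 2.
Proof.
move=> qp; exists (p - 1); split=> //.
- by split; [lia|move=> [[|i] [[|j] e]]; nia].
- split; first lia.
  move=> [[|i] [[|[|j]] e]]; nia.
move=> z zI [_]; apply; exists 0, 1; lia.
Qed.

(** The midpoint would be a positive semigroup element; exchanging one [q] for a [p], or one [p] for
    a [q], shifts it by 1 onto one of the two gaps. *)
Lemma not_gap_diff2 : q = p + 1 -> ~ gap_diff 2.
Proof.
move=> qp [x [[x0 Nx] [y0 Ny] _ no]].
have [i [j xE]] : num_semigroup p q x.+1.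
  have h : ~ gaps p q x.+1 by apply: no; lia.
  by case: (boolp.EM (num_semigroup p q x.+1)) => // N; case: h.
case: i xE => [|i] xE.
  case: j xE => [|j] xE; first lia.
  by apply: Ny; exists 1, j; lia.
by apply: Nx; exists i, j.+1; lia.
Qed.

(** * The subtractive Euclidean algorithm and record residues *)

(* In [euclid_state a k d u], [d] and [u] are the current records for positive
   and negative multiples of [q]: [d = a q] and [u = - k q] modulo [p]. *)
Inductive euclid_state : nat -> nat -> nat -> nat -> Prop :=
| euclid_start : euclid_state 1 0 (q %% p) p
| euclid_left a k d u : euclid_state a k d u -> u < d ->
    euclid_state (a + k) k (d - u) u
| euclid_right a k d u : euclid_state a k d u -> d < u ->
    euclid_state a (a + k) d (u - d).

(** The equation [a * u + k * d = p] is the determinant of the basis, kept when one vector is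
    subtracted from the other; [b] and [b'] turn the congruences into equalities. *)
Definition euclid_inv (a k d u b b' : nat) :=
  [/\ 0 < a, 0 < d < p, 0 < u <= p, a * u + k * d = p
    & a * q = d + b * p /\ k * q + u = b' * p].

Lemma euclid_stateP (a k d u : nat) :
  euclid_state a k d u -> exists b b', euclid_inv a k d u b b'.
Proof.
elim=> {a k d u} [|a k d u _ [b [b' [? ? ? ? [? ?]]]] ?
                  |a k d u _ [b [b' [? ? ? ? [? ?]]]] ?].
- exists (q %/ p), 1; have qE := divn_eq q p.
  have : q %% p < p by rewrite ltn_mod; lia.
  have : q %% p <> 0.
    move=> /eqP pq; have : p %| gcdn p q by rewrite dvdn_gcd dvdnn.
    by rewrite (eqP co_pq) dvdn1; lia.
  by split; lia.
- have [d' dE] : exists d', d = d' + u by exists (d - u); lia.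
  by subst d; rewrite addnK; exists (b + b'), b'; split; lia.
- have [u' uE] : exists u', u = u' + d by exists (u - d); lia.
  by subst u; rewrite addnK; exists b, (b + b'); split; lia.
Qed.

(* Since [a u + k d = p], the vectors [(d, a)] and [(u, - k)] form a basis of
   the lattice containing [(e, c)]; the proof reads off the coordinates
   [m = c b' - f k] and [n = c b - a f]. Positivity of [c] and [e] forces
   [m > 0]; then [n >= 0] gives [e >= d], and [n < 0] gives [c >= a + k]. *)
Lemma euclid_left_min (a k d u c e f : nat) :
  euclid_state a k d u -> 0 < c < a + k -> 0 < e -> c * q = e + f * p -> d <= e.
Proof.
move=> /euclid_stateP[b [b' [a0 d0 u0 det [aE kE]]]] cI e0 cE.
have p0 : 0 < p by lia.
have mE : c * b' * p = f * k * p + (k * e + c * u).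
  have := congr1 (muln c) kE; have := congr1 (muln k) cE; lia.
have nE : c * b * p + c * d = a * f * p + a * e.
  have := congr1 (muln c) aE; have := congr1 (muln a) cE; lia.
have ltm : f * k < c * b'.
  have cu0 : 0 < c * u by rewrite muln_gt0; lia.
  by rewrite -(ltn_pmul2r p0); lia.
have [m cb'E] : exists m, c * b' = f * k + m.+1.
  by exists (c * b' - f * k).-1; lia.
have {mE}mp : m.+1 * p = k * e + c * u by rewrite cb'E in mE; lia.
have [le|lt] := leqP (a * f) (c * b).
  have [n cbE] : exists n, c * b = a * f + n by exists (c * b - a * f); lia.
  have np : n * p + c * d = a * e by rewrite cbE in nE; lia.
  have : e * p = (m.+1 * d + n * u) * p.
    have := congr1 (muln^~ u) np; have := congr1 (muln^~ d) mp.
    have := congr1 (muln e) det; lia.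
  by move=> /eqP; rewrite eqn_pmul2r// => /eqP; lia.
have [n afE] : exists n, a * f = c * b + n.+1.
  by exists (a * f - c * b).-1; lia.
have np : c * d = a * e + n.+1 * p by rewrite afE in nE; lia.
have : c * p = (m.+1 * a + n.+1 * k) * p.
  have := congr1 (muln^~ k) np; have := congr1 (muln^~ a) mp.
  have := congr1 (muln c) det; lia.
by move=> /eqP; rewrite eqn_pmul2r// => /eqP; lia.
Qed.

(** Mirror image for the vector [(e, - c)], with [m = f k - c b'] and [n = a f - c b]: now [n > 0]
    always, [m >= 0] gives [e >= u], and [m < 0] gives [c >= a + k]. *)
Lemma euclid_right_min (a k d u c e f : nat) :
  euclid_state a k d u -> 0 < c < a + k -> 0 < e -> c * q + e = f * p -> u <= e.
Proof.
move=> /euclid_stateP[b [b' [a0 d0 u0 det [aE kE]]]] cI e0 cE.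
have p0 : 0 < p by lia.
have mE : c * b' * p + k * e = f * k * p + c * u.
  have := congr1 (muln c) kE; have := congr1 (muln k) cE; lia.
have nE : a * f * p = c * b * p + (c * d + a * e).
  have := congr1 (muln c) aE; have := congr1 (muln a) cE; lia.
have ltn : c * b < a * f.
  have ae0 : 0 < a * e by rewrite muln_gt0; lia.
  by rewrite -(ltn_pmul2r p0); lia.
have [n afE] : exists n, a * f = c * b + n.+1.
  by exists (a * f - c * b).-1; lia.
have {nE}np : n.+1 * p = c * d + a * e by rewrite afE in nE; lia.
have [le|lt] := leqP (c * b') (f * k).
  have [m fkE] : exists m, f * k = c * b' + m by exists (f * k - c * b'); lia.
  have mp : m * p + c * u = k * e by rewrite fkE in mE; lia.
  have : e * p = (m * d + n.+1 * u) * p.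
    have := congr1 (muln^~ u) np; have := congr1 (muln^~ d) mp.
    have := congr1 (muln e) det; lia.
  by move=> /eqP; rewrite eqn_pmul2r// => /eqP; lia.
have [m cb'E] : exists m, c * b' = f * k + m.+1.
  by exists (c * b' - f * k).-1; lia.
have mp : c * u = k * e + m.+1 * p by rewrite cb'E in mE; lia.
have : c * p = (m.+1 * a + n.+1 * k) * p.
  have := congr1 (muln^~ k) np; have := congr1 (muln^~ a) mp.
  have := congr1 (muln c) det; lia.
by move=> /eqP; rewrite eqn_pmul2r// => /eqP; lia.
Qed.

(** Run the algorithm while [a + k <= c]; each step lowers [d + u]. It cannot stall at [d = u],
    since then [p] would divide [a + k], which is positive and below [p]. *)
Lemma euclid_state_bracket (c : nat) : 0 < c < p ->
  exists a k d u, [/\ euclid_state a k d u, a <= c, k <= c & c < a + k].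
Proof.
move=> cI.
suff H n a k d u : d + u < n -> euclid_state a k d u -> a <= c -> k <= c ->
    exists a k d u, [/\ euclid_state a k d u, a <= c, k <= c & c < a + k].
  by apply: (H (q %% p + p).+1 _ _ _ _ _ euclid_start); lia.
elim: n a k d u => // n IHn a k d u dun st ac kc.
have [lt|le] := ltnP c (a + k); first by exists a, k, d, u.
have [b [b' [a0 d0 u0 det [aE kE]]]] := euclid_stateP st.
have [lt|lt|eq] := ltngtP d u.
- by apply: (IHn _ _ _ _ _ (euclid_right st lt)); lia.
- by apply: (IHn _ _ _ _ _ (euclid_left st lt)); lia.
have : p %| a + k.
  rewrite -(Gauss_dvdl _ co_pq); apply/dvdnP; exists (b + b'); lia.
by move/dvdn_leq; lia.
Qed.

(** * Differences of small elements are the records *)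

Lemma small_diff_euclid (s : nat) : small_diff s ->
  exists a k d u, euclid_state a k d u /\ (s = d \/ s = u).
Proof.
move=> [x [Sx Sy s0 no]].
have {}no := small_between Sy no.
have [i [j [ip xE]]] := num_semigroup_coef_ltn Sx.1.
have [i' [j' [ip' yE]]] := num_semigroup_coef_ltn Sy.1.
(* Adding [p] stays in the semigroup. *)
have sp : s <= p.
  by rewrite leqNgt; apply/negP => ps; apply: (no (x + p));
    [lia|exists i, j.+1; lia].
have p0 : 0 < p by lia.
have [lt|lt|eqi] := ltngtP i i'.
- have [c i'E] : exists c, i' = i + c by exists (i' - i); lia.
  subst i'.
  have qc : q <= c * q by rewrite leq_pmull; lia.
  have jj' : j' <= j by rewrite -(leq_pmul2r p0); lia.
  have [f jE] : exists f, j = j' + f by exists (j - j'); lia.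
  subst j.
  have cE : c * q = s + f * p by lia.
  have [a [k [d [u [st ac kc cak]]]]] := @euclid_state_bracket c ltac:(lia).
  exists a, k, d, u; split=> //; left.
  have [b [b' [a0 d0 u0 det [aE kE]]]] := euclid_stateP st.
  have cI : 0 < c < a + k by lia.
  have ds : d <= s := euclid_left_min st cI s0 cE.
  (* If [d < s], then [x + d] is a semigroup element strictly between: trade [b] copies of [p] for
     [a] copies of [q]. *)
  have [sd|sd] := leqP s d; first by lia.
  have aqc : a * q <= c * q by rewrite leq_mul2r ac orbT.
  have bf : b <= f by rewrite -ltnS -(ltn_pmul2r p0); lia.
  have [g fE] : exists g, f = b + g by exists (f - b); lia.
  by subst f; case: (no (x + d)); [lia|exists (i + a), (j' + g); lia].
- have [c iE] : exists c, i = i' + c by exists (i - i'); lia.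
  subst i.
  have jj' : j <= j' by rewrite -(leq_pmul2r p0); lia.
  have [f jE] : exists f, j' = j + f by exists (j' - j); lia.
  subst j'.
  have cE : c * q + s = f * p by lia.
  have [a [k [d [u [st ac kc cak]]]]] := @euclid_state_bracket c ltac:(lia).
  exists a, k, d, u; split=> //; right.
  have [b [b' [a0 d0 u0 det [aE kE]]]] := euclid_stateP st.
  have cI : 0 < c < a + k by lia.
  have us : u <= s := euclid_right_min st cI s0 cE.
  have [su|su] := leqP s u; first by lia.
  have [g gE] : exists g, c = k + g by exists (c - k); lia.
  by subst c; case: (no (x + u)); [lia|exists (i' + g), (j + b'); lia].
exists 1, 0, (q %% p), p; split; first exact: euclid_start.
right; subst i'.
have jj' : j < j' by rewrite -(ltn_pmul2r p0); lia.
have jp : j.+1 * p <= j' * p by rewrite leq_mul2r jj' orbT.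
by lia.
Qed.

(** The pair is [b * p] and [a * q]. The bound on [a] keeps it within [phi p q], and an element
    strictly between would contradict the minimality of [d]. *)
Lemma euclid_left_diff (a k d u : nat) : euclid_state a k d u -> a <= p - 2 ->
  small_diff d.
Proof.
move=> st ap; have [b [b' [a0 d0 u0 det [aE kE]]]] := euclid_stateP st.
have p0 : 0 < p by lia.
have q0 : 0 < q by lia.
have aqF : a.+2 * q <= p * q by rewrite leq_mul2r; lia.
exists (b * p); split; last 2 first.
- lia.
- move=> z zI [[c [j zE]] _].
  case: c zE => [|c] zE.
    have bj : b < j by rewrite -(ltn_pmul2r p0); lia.
    have jb : j < b.+1 by rewrite -(ltn_pmul2r p0); lia.
    by lia.
  have ca : c.+1 < a by rewrite -(ltn_pmul2r q0); lia.
  have jb : j < b by rewrite -(ltn_pmul2r p0); lia.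
  have [f bE] : exists f, b = j + f by exists (b - j); lia.
  have := @euclid_left_min _ _ _ _ c.+1 (z - b * p) f st.
  by subst b; lia.
- by split; [exists 0, b|rewrite /= phiE]; lia.
- by split; [exists a, 0|rewrite /= phiE]; lia.
Qed.

Lemma euclid_right_diff (a k d u : nat) : euclid_state a k d u -> k <= p - 2 ->
  small_diff u.
Proof.
move=> st kp; have [b [b' [a0 d0 u0 det [aE kE]]]] := euclid_stateP st.
have p0 : 0 < p by lia.
have kqF : b' * p <= F.+1.
  have [lt|ge] := ltnP k (p - 2).
    have : k.+3 * q <= p * q by rewrite leq_mul2r; lia.
    by lia.
  (* In this extreme case the determinant leaves at most 2 for [a * u], so [k * q + u] still fits
     below [phi p q]. *)
  have kE' : p = k.+2 by lia.
  have u2 : u <= 2.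
    have : u <= a * u by rewrite leq_pmull.
    have : k <= k * d by rewrite leq_pmulr; lia.
    by lia.
  have : p * q = k * q + q + q by rewrite {1}kE'; lia.
  by lia.
exists (k * q); split; last 2 first.
- lia.
- move=> z zI [[c [j zE]] _].
  have [lt|lt|eq] := ltngtP c k.
  + have [g kcE] : exists g, k = c + g by exists (k - c); lia.
    have := @euclid_right_min _ _ _ _ g (z - k * q) j st.
    by subst k; lia.
  + have : k.+1 * q <= c * q by rewrite leq_mul2r lt orbT.
    by lia.
  + subst c; case: j zE => [|j]; lia.
- by split; [exists k, 0|rewrite /= phiE]; lia.
- by split; [exists 0, b'|rewrite /= phiE]; lia.
Qed.

(** When [a] or [k] exceeds [p - 2], the determinant forces [d = u = 1], and the record on the other
    side provides this value. *)
Lemma euclid_small_diff (a k d u : nat) : euclid_state a k d u ->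
  small_diff d /\ small_diff u.
Proof.
move=> st; have [b [b' [a0 d0 u0 det [aE kE]]]] := euclid_stateP st.
have big x y v w : p - 2 < x -> 0 < v -> 0 < y -> 0 < w ->
    x * v + y * w = p -> [/\ v = 1, w = 1 & y = 1].
  move=> xp v0 y0 w0 e.
  have xv : x * v >= x by rewrite leq_pmulr.
  have yw : y * w >= y by rewrite leq_pmulr.
  have wy : y * w >= w by rewrite leq_pmull.
  have [v1|v1] := leqP v 1; first by split; lia.
  exfalso; have : x * 2 <= x * v by rewrite leq_mul2l v1 orbT.
  by lia.
have [d_gt0 _] := andP d0; have [u_gt0 _] := andP u0.
have det' : k * d + a * u = p by rewrite addnC.
have k_gt0 : p - 2 < a -> 0 < k.
  move=> ap; rewrite lt0n; apply/eqP => k0; subst k.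
  have pb : p <= b' * p by rewrite leq_pmull; case: b' kE => [|b']; lia.
  have : 2 * u <= a * u by rewrite leq_mul2r; lia.
  by lia.
have [ap|ap] := leqP a (p - 2); have [kp|kp] := leqP k (p - 2).
- by split; [exact: euclid_left_diff st _|exact: euclid_right_diff st _].
- have h := euclid_left_diff st ap; split=> //.
  by have [d1 u1 _] := big k a d u kp d_gt0 a0 u_gt0 det'; rewrite u1 -d1.
- have h := euclid_right_diff st kp; split=> //.
  by have [u1 d1 _] := big a k u d ap u_gt0 (k_gt0 ap) d_gt0 det; rewrite d1 -u1.
- by have [_ _ k1] := big a k u d ap u_gt0 (k_gt0 ap) d_gt0 det; lia.
Qed.

(** * Subtractive steps inside the divisions with remainder *)

Section Division.
Variables (t : nat) (r Z : nat -> nat).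
Hypothesis rZ : euclidean_algorithm p q t r Z.

Let r0 : r 0 = p. Proof. by case: rZ. Qed.
Let r1 : r 1 = q %% p. Proof. by case: rZ. Qed.
Let rt : r t = 1. Proof. by case: rZ. Qed.
Let rS i : 0 < i <= t -> r i.-1 = Z i * r i + r i.+1 /\ r i.+1 < r i.
Proof. by case: rZ => _ _ h _ /h; rewrite subn1. Qed.

Let r_lt i : i <= t -> r i.+1 < r i.
Proof.
case: i => [_|i it]; last by have [] := @rS i.+1 it.
by rewrite r0 r1 ltn_mod; lia.
Qed.

Let Z_gt0 i : 0 < i <= t -> 0 < Z i.
Proof.
case: i => // i it; have [/= e lt] := @rS i.+1 it.
have lt' : r i.+1 < r i by apply: r_lt; lia.
by rewrite lt0n; apply/eqP => Z0; rewrite Z0 in e; lia.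
Qed.

Let t_gt0 : 0 < t.
Proof. by rewrite lt0n; apply/eqP => t0; move: rt; rewrite t0 r0; lia. Qed.

Let subrZ i : 0 < i <= t -> r i.-1 - Z i * r i = r i.+1.
Proof. by move=> /rS[-> _]; rewrite addKn. Qed.

Let subrS i z : 0 < i <= t -> z < Z i ->
  r i.-1 - z * r i = r i + (r i.-1 - z.+1 * r i).
Proof.
move=> /rS[e _] zZ; have : z.+1 * r i <= Z i * r i by rewrite leq_mul2r zZ orbT.
by lia.
Qed.

(** Position in the [i]-th division after [z] subtractions: [x] is the divisor, [y] what is left of
    the dividend. *)
Let at_step x y i z := x = r i /\ y = r i.-1 - z * r i.

Lemma euclid_state_step (a k d u : nat) : euclid_state a k d u ->
  exists i z, [/\ 0 < i <= t, z < Z i & at_step d u i z \/ at_step u d i z].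
Proof.
have next x y i z : 0 < i <= t -> z < Z i -> at_step x y i z -> x < y ->
    exists i z, [/\ 0 < i <= t, z < Z i &
      at_step x (y - x) i z \/ at_step (y - x) x i z].
  move=> it zZ [-> ->]; rewrite (subrS it zZ) addKn => lt.
  have [zS|zS] := ltnP z.+1 (Z i); first by exists i, z.+1; split=> //; left.
  have ZE : z.+1 = Z i by lia.
  rewrite ZE (subrZ it) in lt *.
  (* In the last division the divisor is 1 and the remainder 0, which [lt] excludes. *)
  have lti : i < t.
    rewrite ltnNge; apply/negP => ti; have ie : i = t by lia.
    by have := r_lt (leqnn t); rewrite rt -ie; lia.
  exists i.+1, 0; split; [lia|by apply: Z_gt0; lia|right; split=> //=].
  by rewrite mul0n subn0.
(* The divisor is never the larger value, so the direction of a step tells which of [d] and [u] it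
   is. *)
have nle x y i z : 0 < i <= t -> z < Z i -> at_step x y i z -> x <= y.
  by move=> it zZ [-> ->]; rewrite (subrS it zZ) leq_addr.
elim=> {a k d u} [|a k d u _ [i [z [it zZ h]]] lt|a k d u _ [i [z [it zZ h]]] lt].
- exists 1, 0; split=> //; first exact: Z_gt0.
  by left; split; rewrite ?r1//= r0; lia.
- case: h => h; first by have := nle _ _ _ _ it zZ h; lia.
  have [i' [z' [? ? h']]] := next _ _ _ _ it zZ h lt.
  by exists i', z'; split=> //; case: h'; [right|left].
- case: h => h; last by have := nle _ _ _ _ it zZ h; lia.
  exact: next it zZ h lt.
Qed.

Lemma euclid_step_state (i z : nat) : 0 < i <= t -> z < Z i ->
  exists a k, euclid_state a k (r i) (r i.-1 - z * r i) \/
              euclid_state a k (r i.-1 - z * r i) (r i).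
Proof.
have next x y : x < y ->
    (exists a k, euclid_state a k x y \/ euclid_state a k y x) ->
    exists a k, euclid_state a k x (y - x) \/ euclid_state a k (y - x) x.
  move=> lt [a [k [h|h]]].
    by exists a, (a + k); left; exact: euclid_right h lt.
  by exists (a + k), k; right; exact: euclid_left h lt.
elim: i z => // i IHi z it.
elim: z => [|z IHz] zZ; last first.
  have := subrS it (ltnW zZ); have := subrS it zZ => e1 e0.
  have ri : 0 < r i.+1 by apply: leq_ltn_trans (r_lt _) => //; lia.
  have := IHz (ltnW zZ); rewrite e0 => /next; rewrite addKn; apply.
  by rewrite e1; lia.
rewrite mul0n subn0 /=.
case: i IHi it zZ => [_ _ _|i IHi it zZ].
  by exists 1, 0; left; rewrite r0 r1; exact: euclid_start.
have it' : 0 < i.+1 <= t by lia.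
have Z0 := Z_gt0 it'.
have lt := @r_lt i.+2 it.
(* The start of a division is reached by one more subtraction from the last position of the previous
   one. *)
have lZ : (Z i.+1).-1 < Z i.+1 by lia.
have := IHi _ it' lZ; rewrite (subrS it' lZ) prednK// (subrZ it').
move=> /next; rewrite addKn => /(_ ltac:(lia)) [a [k h]].
by exists a, k; case: h; [right|left].
Qed.

Lemma small_diffE (s : nat) : small_diff s <-> euclidean_differences t r Z s.
Proof.
split.
  move=> /small_diff_euclid[a [k [d [u [/euclid_state_step]]]]].
  move=> [i [z [it zZ h]]] su.
  have [e ltr] := rS it.
  have : s = r i.-1 - z * r i \/ s = r i by case: h su => -[-> ->] [->|->]; auto.
  case=> {su}sE; first by exists i, z; rewrite subn1.
  (* A divisor [r i] is the value at [z = 0] of the next division; for [i = t] it equals 1, the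
     value at [z = Z t - 1] because [r t.+1 = 0]. *)
  have [lti|gei] := ltnP i t.
    exists i.+1, 0; split=> //; first by apply: Z_gt0; lia.
    by rewrite subn1 /= mul0n subn0.
  have ie : i = t by lia.
  subst i; exists t, (Z t).-1; rewrite subn1 rt in e ltr *.
  by split; rewrite ?rt//; lia.
move=> [i [z [it zZ ->]]]; rewrite subn1.
by have [a [k [h|h]]] := euclid_step_state it zZ;
  have [] := euclid_small_diff h.
Qed.

End Division.
End Semigroup.

Unset Implicit Arguments.
Set Strict Implicit.

Theorem theorem1 (p q : nat) (hp : 3 <= p) (hpq : p < q) (hco : coprime p q)
  (l n : nat -> nat)
  (hl : lists_increasingly l 0 (theta p q) (small_elements p q))
  (hn : lists_increasingly n 1 (theta p q) (gaps p q))
  (t : nat) (r Z : nat -> nat) (hr : euclidean_algorithm p q t r Z) :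
  let SDelta := consecutive_differences l 0 (theta p q) in
  let NDelta := consecutive_differences n 1 (theta p q) in
  [/\ q <> p + 1 -> SDelta = NDelta,
      q = p + 1 -> SDelta = NDelta `|` [set 2] /\ ~ NDelta 2
    & SDelta = euclidean_differences t r Z].
Proof.
move=> SDelta NDelta.
have SE d : SDelta d <-> small_diff p q d := consecutive_differencesP d hl.
have NE d : NDelta d <-> gap_diff p q d := consecutive_differencesP d hn.
split=> [qp|qp|].
- apply/seteqP; split=> d.
    move=> /SE/(small_diff_gap hp hpq hco)[/NE//|->].
    by apply/NE; exact: gap_diff2.
  by move=> /NE/(gap_diff_small hp hpq hco)/SE.
- split; last by move=> /NE; exact: not_gap_diff2.
  apply/seteqP; split=> d.
    by move=> /SE/(small_diff_gap hp hpq hco)[/NE|]; [left|right].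
  move=> [/NE/(gap_diff_small hp hpq hco)/SE//|->].
  by apply/SE; exact: small_diff2.
- apply/seteqP; split=> d.
    by move=> /SE/(small_diffE hp hpq hco hr).
  by move=> /(small_diffE hp hpq hco hr)/SE.
Qed.
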